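(* Let $\Delta$ be the set of all coroots of $\mathbf G$ and put $$X=\Lambda,\qquad \Phi=\{n_\alpha\alpha\mid\alpha\in\Delta\},\qquad X'=\mathrm{Hom}(\Lambda,\mathbb{Z})\subset\mathrm{Hom}(\mathbf T,\mathbb{G}_m)\otimes\mathbb{Q},\qquad \Phi'=\{n_\alpha^{-1}\alpha^\vee\mid\alpha\in\Delta\}.$$ Then the quadruple $(X,\Phi,X',\Phi')$ defines a root datum.
   Context: $F$ is a non-archimedean local field with ring of integers $O_F$ and residue field of cardinality $q$; $n$ is a positive integer with $2n\mid q-1$. $\mathbf G$ is a split reductive group scheme over $O_F$ with maximal split torus $\mathbf T$, cocharacter group $Y=\mathrm{Hom}(\mathbb{G}_m,\mathbf T)$ and Weyl group $W$. For a coroot $\alpha\in Y$, $\alpha^\vee\in\mathrm{Hom}(\mathbf T,\mathbb{G}_m)$ denotes the corresponding root. $B:Y\times Y\to\mathbb{Z}$ is a $W$-invariant symmetric bilinear form such that $Q(\alpha)=B(\alpha,\alpha)/2\in\mathbb{Z}$ for all coroots $\alpha$. For each coroot $\alpha$, $n_\alpha=n/\gcd(n,Q(\alpha))$. $\Lambda=\{x\in Y\mid B(x,y)\in n\mathbb{Z}\ \ \forall y\in Y\}$. The bijection $\Phi\to\Phi'$ is $n_\alpha\alpha\mapsto n_\alpha^{-1}\alpha^\vee$ and the pairing between $X$ and $X'$ is the evident one. *)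

(* Defs.v *)
From HB Require Import structures.
From mathcomp Require Import all_boot all_order all_algebra.
From mathcomp Require Import boolp classical_sets functions cardinality.

Set Implicit Arguments.
Unset Strict Implicit.
Unset Printing Implicit Defensive.

Import Order.TTheory GRing.Theory Num.Theory.
Local Open Scope classical_set_scope.
Local Open Scope ring_scope.

(** * Non-archimedean local fields *)

(* A valuation is an [int]-valued function whose value at 0 is irrelevant:
   [val_ge v m x] is "v(x) >= m" with the convention v(0) = +oo. *)
Definition val_ge (F : fieldType) (v : F -> int) (m : int) (x : F) : bool :=
  (x == 0) || (m <= v x).

(* [F] is complete for the normalized discrete valuation [v], and [res] is the
   reduction map from O_F = [val_ge v 0] onto the finite residue field [k]
   (the values of [res] outside O_F are irrelevant). *)
Record local_field (F : fieldType) (v : F -> int)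
    (k : finFieldType) (res : F -> k) : Prop := LocalField {
  lf_valM : forall x y, x != 0 -> y != 0 -> v (x * y) = v x + v y;
  lf_valD : forall m x y, val_ge v m x -> val_ge v m y -> val_ge v m (x + y);
  lf_uniformizer : exists2 t, t != 0 & v t = 1;
  lf_complete : forall u : nat -> F,
    (forall m, exists N, forall i j, (N <= i)%N -> (N <= j)%N ->
      val_ge v m (u i - u j)) ->
    exists l, forall m, exists N, forall i, (N <= i)%N -> val_ge v m (u i - l);
  lf_res1 : res 1 = 1;
  lf_resD : forall x y, val_ge v 0 x -> val_ge v 0 y ->
    res (x + y) = res x + res y;
  lf_resM : forall x y, val_ge v 0 x -> val_ge v 0 y ->
    res (x * y) = res x * res y;
  lf_res_ker : forall x, val_ge v 0 x -> (res x == 0) = val_ge v 1 x;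
  lf_res_surj : forall c, exists2 x, val_ge v 0 x & res x = c
}.

(** * Root data *)

(* [X] is a subgroup of [V] that is free of finite rank. *)
Definition lattice (V : zmodType) (X : set V) : Prop :=
  exists (r : nat) (e : 'I_r -> V),
    (forall x, X x <-> exists c : 'I_r -> int, x = \sum_i e i *~ c i) /\
    (forall c : 'I_r -> int, \sum_i e i *~ c i = 0 -> forall i, c i = 0).

(* [f] restricts to a group homomorphism from [X] to Z. *)
Definition hom_on (V : zmodType) (X : set V) (f : V -> int) : Prop :=
  forall x y, X x -> X y -> f (x + y) = f x + f y.

Definition reflection (V V' : zmodType) (p : V -> V' -> int)
    (a : V) (a' : V') (x : V) : V :=
  x - a *~ p x a'.

(* The quadruple (X, Phi, X', Phi') with X, X' subgroups of the groups V, V'.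
   [p] is the pairing X x X' -> Z and [vee] the bijection Phi -> Phi';
   their values elsewhere are irrelevant. *)
Record root_datum (V V' : zmodType) (X Phi : set V) (X' Phi' : set V')
    (p : V -> V' -> int) (vee : V -> V') : Prop := RootDatum {
  rd_lattice : lattice X;
  rd_lattice' : lattice X';
  rd_pairDl : forall x y x', X x -> X y -> X' x' ->
    p (x + y) x' = p x x' + p y x';
  rd_pairDr : forall x x' y', X x -> X' x' -> X' y' ->
    p x (x' + y') = p x x' + p x y';
  rd_perfect : forall f, hom_on X f ->
    exists! x', X' x' /\ forall x, X x -> p x x' = f x;
  rd_perfect' : forall f, hom_on X' f ->
    exists! x, X x /\ forall x', X' x' -> p x x' = f x';
  rd_sub : Phi `<=` X;
  rd_sub' : Phi' `<=` X';
  rd_finite : finite_set Phi;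
  rd_vee : set_bij Phi Phi' vee;
  rd_pair2 : forall a, Phi a -> p a (vee a) = 2;
  rd_refl : forall a, Phi a -> reflection p a (vee a) @` Phi = Phi;
  rd_refl' : forall a, Phi a ->
    reflection (fun x' x => p x x') (vee a) a @` Phi' = Phi'
}.

Definition reduced (V : zmodType) (Phi : set V) : Prop :=
  forall (a b : V) (k l : int), Phi a -> Phi b -> k != 0 ->
    a *~ k = b *~ l -> b = a \/ b = - a.

(* The group generated by the reflections; inverses are not needed since
   reflections are involutions. *)
Inductive weyl_group (V V' : zmodType) (Phi : set V)
    (p : V -> V' -> int) (vee : V -> V') : (V -> V) -> Prop :=
| weyl_id : weyl_group Phi p vee id
| weyl_refl a w : Phi a -> weyl_group Phi p vee w ->
    weyl_group Phi p vee (reflection p a (vee a) \o w).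

(** * The metaplectic data attached to an invariant form *)

Record invariant_form (Y M : zmodType) (Delta : set Y)
    (p : Y -> M -> int) (vee : Y -> M) (B : Y -> Y -> int) : Prop :=
  InvariantForm {
  form_sym : forall x y, B x y = B y x;
  form_addl : forall x y z, B (x + y) z = B x z + B y z;
  form_weyl : forall w, weyl_group Delta p vee w ->
    forall x y, B (w x) (w y) = B x y;
  form_even : forall a, Delta a -> (2 %| B a a)%Z
}.

Definition Qform (Y : zmodType) (B : Y -> Y -> int) (a : Y) : int :=
  (B a a %/ 2)%Z.

Definition n_coroot (Y : zmodType) (B : Y -> Y -> int) (n : nat) (a : Y) : nat :=
  (n %/ gcdn n `|Qform B a|)%N.

Definition Lambda (Y : zmodType) (B : Y -> Y -> int) (n : nat) : set Y :=
  [set x | forall y, (n%:Z %| B x y)%Z].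

(* Universal property of the map m |-> m (x) 1 from M to M (x)_Z Q. *)
Definition is_tensorQ (M : zmodType) (MQ : lmodType rat)
    (iota : {additive M -> MQ}) : Prop :=
  forall (E : lmodType rat) (f : {additive M -> E}),
    exists g : {linear MQ -> E}, (forall m, g (iota m) = f m) /\
      forall h : {linear MQ -> E}, (forall m, h (iota m) = f m) -> h =1 g.

(* Hom(L, Z) as a subset of M (x) Q: the rational characters whose restriction
   to L, through the pairing [pQ], is a homomorphism from L to Z. *)
Definition hom_lattice (Y : zmodType) (MQ : lmodType rat)
    (pQ : Y -> {scalar MQ}) (L : set Y) : set MQ :=
  [set chi | exists2 f : Y -> int, hom_on L f &
    forall x, L x -> pQ x chi = (f x)%:~R].

(* The pairing of [pQ] takes integral values on L x Hom(L, Z); on such values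
   [Num.floor] is the identification of the integers of [rat] with [int]. *)
Definition int_pairing (Y : zmodType) (MQ : lmodType rat)
    (pQ : Y -> {scalar MQ}) (x : Y) (chi : MQ) : int :=
  Num.floor (pQ x chi : rat).

(* Main.v *)
Require Import Defs.
From HB Require Import structures.
From mathcomp Require Import all_boot all_order all_algebra.
From mathcomp Require Import boolp classical_sets functions cardinality.
From mathcomp Require Import zify ring.

Set Implicit Arguments.
Unset Strict Implicit.
Unset Printing Implicit Defensive.

Import Order.TTheory GRing.Theory Num.Theory.
Local Open Scope classical_set_scope.
Local Open Scope ring_scope.

(** The reflections of the new quadruple are the old ones in disguise.  For a
coroot [a] invariance of [B] under the reflection in [a] gives
[B y a = p y (vee a) * Q a]: the form against a coroot is a multiple of the
corresponding root ([invariant_form_coroot]).  Writing [N a] for n_a, so that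
[n] divides [z * Q a] exactly when [N a] divides [z], this identity says both
that [N a * a] lies in [Lambda] and that [vee a] takes values divisible by
[N a] on [Lambda], i.e. that [vee a / N a] lies in the dual of [Lambda].  The
factors cancel in the pairing of [N a * a] with [vee a / N a], which is again 2,
and in the two reflections, which act on the scaled coroots and roots as the
original ones do; since [Q], hence [N], is invariant under reflections, the
scaled sets are stable.

On the side of the roots this needs [vee (s_a b)] to be the reflection of
[vee b] in [vee a], and the bijectivity of the map from scaled coroots to
scaled roots needs: if [vee a / N a = vee b / N b] then [N a * a = N b * b].
Neither is part of the axioms of a root datum; both express that in a finite
root system a coroot is determined by its root, and both are instances of
[proportional_reflections].  If the covectors of two reflections are
proportional, their product is a transvection, so an infinite orbit in the
finite set of coroots appears unless the vectors are proportional too.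

The lattice side is linear algebra over the integers.  [Lambda] is the kernel of
the Gram matrix of [B] modulo [n], and the Smith normal form of that matrix
exhibits a basis of it ([Lambda_lattice]).  A homomorphism [f] from [Lambda] to
the integers extends to the rational character [y |-> f (n * y) / n], and the
universal property of M (x) Q makes a rational character determined by its values
on [Y] ([tensorQ_coord]); hence the pairing identifies the rational characters
integral on [Lambda] with all the homomorphisms ([hom_lattice_perfect]), and the
remaining half of duality is formal ([perfect_dual]). *)

(** * Homomorphisms on subgroups, and lattices *)

Definition subgroup (V : zmodType) (X : set V) : Prop :=
  [/\ X 0, forall x y, X x -> X y -> X (x + y) & forall x, X x -> X (- x)].

Definition torsion_free (V : zmodType) : Prop :=
  forall (x : V) (k : nat), (0 < k)%N -> x *+ k = 0 -> x = 0.

Lemma subgroupT (V : zmodType) : subgroup [set: V].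
Proof. by []. Qed.

Lemma subgroup_mulrz (V : zmodType) (X : set V) (sX : subgroup X) x (m : int) :
  X x -> X (x *~ m).
Proof.
case: sX => X0 XD XN Xx.
have XM k : X (x *+ k).
  by elim: k => [|k IHk]; rewrite ?mulr0n // mulrS; apply: XD.
by case: m => k; [apply: XM | rewrite NegzE mulrNz; apply/XN/XM].
Qed.

Lemma subgroup_sum (V : zmodType) (X : set V) (sX : subgroup X)
    (I : finType) (e : I -> V) : (forall i, X (e i)) -> X (\sum_i e i).
Proof.
by case: sX => X0 XD _ Xe; apply: (big_ind X) => // x y; apply: XD.
Qed.

Lemma subgroup_comb (V : zmodType) (X : set V) (sX : subgroup X)
    r (e : 'I_r -> V) (c : 'I_r -> int) :
  (forall i, X (e i)) -> X (\sum_i e i *~ c i).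
Proof. by move=> Xe; apply: subgroup_sum => // i; apply: subgroup_mulrz. Qed.

Lemma hom_on0 (V : zmodType) (X : set V) (sX : subgroup X) f :
  hom_on X f -> f 0 = 0.
Proof.
case: sX => X0 _ _ fD; apply: (addrI (f 0)).
by rewrite -fD // !addr0.
Qed.

Lemma hom_onN (V : zmodType) (X : set V) (sX : subgroup X) f x :
  hom_on X f -> X x -> f (- x) = - f x.
Proof.
move=> fD Xx; apply: (addrI (f x)); case: (sX) => _ _ XN.
by rewrite -fD ?subrr ?(hom_on0 sX) //; apply: XN.
Qed.

Lemma hom_onMn (V : zmodType) (X : set V) (sX : subgroup X) f x k :
  hom_on X f -> X x -> f (x *+ k) = f x *+ k.
Proof.
move=> fD Xx; elim: k => [|k IHk]; first by rewrite !mulr0n (hom_on0 sX).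
by rewrite !mulrS fD ?IHk //; apply: (subgroup_mulrz sX k%:Z).
Qed.

Lemma hom_onMz (V : zmodType) (X : set V) (sX : subgroup X) f x (m : int) :
  hom_on X f -> X x -> f (x *~ m) = f x *~ m.
Proof.
move=> fD Xx; case: m => k; first exact: (hom_onMn sX).
rewrite NegzE !mulrNz (hom_onN sX) //; last exact: (subgroup_mulrz sX k.+1%:Z).
by rewrite -!pmulrn (hom_onMn sX).
Qed.

Lemma hom_on_sum (V : zmodType) (X : set V) (sX : subgroup X) f
    (I : finType) (e : I -> V) :
  hom_on X f -> (forall i, X (e i)) -> f (\sum_i e i) = \sum_i f (e i).
Proof.
move=> fD Xe; case: (sX) => X0 XD _.
suff [] : f (\sum_i e i) = \sum_i f (e i) /\ X (\sum_i e i) by [].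
apply: (big_ind2 (fun x z => f x = z /\ X x)) => [|x fx y fy [<- Xx] [<- Xy]|i _] //.
- by rewrite (hom_on0 sX).
- by rewrite fD //; split=> //; apply: XD.
Qed.

Lemma hom_on_comb (V : zmodType) (X : set V) (sX : subgroup X) f
    r (e : 'I_r -> V) (c : 'I_r -> int) :
  hom_on X f -> (forall i, X (e i)) ->
  f (\sum_i e i *~ c i) = \sum_i f (e i) *~ c i.
Proof.
move=> fD Xe; rewrite (hom_on_sum sX) //; last first.
  by move=> i; apply: subgroup_mulrz.
by apply: eq_bigr => i _; rewrite (hom_onMz sX).
Qed.

Lemma lattice_subgroup (V : zmodType) (X : set V) : lattice X -> subgroup X.
Proof.
case=> r [e [eX _]]; split.
- by apply/eX; exists (fun=> 0); rewrite big1 // => i _; rewrite mulr0z.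
- move=> x y /eX[c ->] /eX[d ->]; apply/eX; exists (fun i => c i + d i).
  by rewrite -big_split; apply: eq_bigr => i _; rewrite mulrzDr.
- move=> x /eX[c ->]; apply/eX; exists (fun i => - c i).
  by rewrite -sumrN; apply: eq_bigr => i _; rewrite mulrNz.
Qed.

Lemma sum_delta (V : zmodType) r (g : 'I_r -> V) (j : 'I_r) :
  \sum_i g i *~ (i == j)%:R = g j.
Proof.
rewrite (bigD1 j) //= eqxx mulr1z big1 ?addr0 // => i /negPf->.
by rewrite mulr0z.
Qed.

(** The coordinate functions are the useful form of a basis: they are
homomorphisms, so perfectness of a pairing applies to them. *)
Lemma lattice_coord (V : zmodType) (X : set V) : lattice X ->
  exists r (e : 'I_r -> V) (c : 'I_r -> V -> int),
    [/\ forall i, X (e i), forall i, hom_on X (c i),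
        forall i j, c i (e j) = (i == j)%:R &
        forall x, X x -> x = \sum_i e i *~ c i x].
Proof.
move=> lX; have [X0 XD XN] := lattice_subgroup lX.
case: lX => r [e [eX efree]].
have /choice[c cP] : forall x, exists c : 'I_r -> int,
    X x -> x = \sum_i e i *~ c i.
  move=> x; have [Xx|nXx] := pselect (X x); last by exists (fun=> 0).
  by case/eX: Xx => c ->; exists c.
have uniq_c (b d : 'I_r -> int) :
    \sum_i e i *~ b i = \sum_i e i *~ d i -> b =1 d.
  move=> bd i; apply/eqP; rewrite -subr_eq0; apply/eqP.
  apply: (efree (fun i => b i - d i)).
  under eq_bigr do rewrite mulrzBr.
  by rewrite sumrB bd subrr.
have Xe i : X (e i).
  by apply/eX; exists (fun j => (j == i)%:R); rewrite sum_delta.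
exists r, e, (fun i x => c x i); split => //.
- move=> i x y Xx Xy.
  apply: (uniq_c (c (x + y)) (fun i => c x i + c y i)).
  rewrite -cP; last exact: XD.
  under eq_bigr do rewrite mulrzDr.
  by rewrite big_split -!cP.
- move=> i j; apply: (uniq_c (c (e j)) (fun i => (i == j)%:R)).
  by rewrite -cP // sum_delta.
Qed.

Lemma lattice_torsion_free (V : zmodType) :
  lattice [set: V] -> torsion_free V.
Proof.
move=> lV; have sV := lattice_subgroup lV.
have [r [e [c [_ chom _ cE]]]] := lattice_coord lV.
move=> x k k0 xk; rewrite (cE x) // big1 // => i _.
have /eqP : c i x *+ k = 0 by rewrite -(hom_onMn sV) // xk (hom_on0 sV).
by rewrite mulrn_eq0 -leqn0 leqNgt k0 => /eqP->.
Qed.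

(** The elements of [X'] representing the coordinate functions of a basis of [X]
form a dual basis.  It spans [X'] because an element of [X'] is determined by its
values on [X], and a homomorphism on [X'] is then the pairing with the
combination of the basis of [X] whose coefficients are its values on the dual
basis. *)
Lemma perfect_dual (V V' : zmodType) (X : set V) (X' : set V')
    (p : V -> V' -> int) :
  lattice X -> subgroup X' ->
  (forall x', X' x' -> hom_on X (p^~ x')) ->
  (forall x, X x -> hom_on X' (p x)) ->
  (forall f, hom_on X f -> exists! x', X' x' /\ forall x, X x -> p x x' = f x) ->
  lattice X' /\
  forall f, hom_on X' f -> exists! x, X x /\ forall x', X' x' -> p x x' = f x'.
Proof.
move=> lX sX' pl pr perf; have sX := lattice_subgroup lX.
have [r [e [c [Xe chom ce cE]]]] := lattice_coord lX.
have /choice[b bP] : forall i, exists x', X' x' /\ forall x, X x -> p x x' = c i x.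
  by move=> i; have [x' [? _]] := perf _ (chom i); exists x'.
have Xb i : X' (b i) by case: (bP i).
have bc i x : X x -> p x (b i) = c i x by case: (bP i) => _; apply.
have bE x' : X' x' -> x' = \sum_i b i *~ p (e i) x'.
  move=> Xx'; have [y [_ yU]] := perf _ (pl _ Xx').
  transitivity y; first by apply/esym/yU.
  apply: yU; split; first exact: subgroup_comb.
  move=> x Xx; rewrite (hom_on_comb sX') //; last exact: pr.
  rewrite {2}(cE x) // (hom_on_comb sX _ (pl _ Xx')) //=.
  by apply: eq_bigr => i _; rewrite bc // !mulrzz mulrC.
split.
  exists r, b; split.
    move=> x'; split; first by move=> /bE->; eexists.
    by case=> d ->; apply: subgroup_comb.
  move=> d d0 i.
  have : p (e i) (\sum_j b j *~ d j) = 0.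
    by rewrite d0 (hom_on0 sX') //; apply: pr.
  rewrite (hom_on_comb sX') //; last exact: pr.
  under eq_bigr => j do rewrite bc // ce mulrzz mulrC -mulrzz.
  by rewrite sum_delta.
move=> f fhom; exists (\sum_i e i *~ f (b i)); split.
  split; first exact: subgroup_comb.
  move=> x' Xx'; rewrite (hom_on_comb sX _ (pl _ Xx')) //=.
  rewrite {2}(bE x') // (hom_on_comb sX') //.
  by apply: eq_bigr => i _; rewrite !mulrzz mulrC.
move=> y [Xy yf]; rewrite [RHS](cE y) //.
by apply: eq_bigr => i _; rewrite -bc // yf.
Qed.

Lemma pairing_additive (V V' : zmodType) (X Phi : set V) (X' Phi' : set V')
    (p : V -> V' -> int) (vee : V -> V') :
  root_datum X Phi X' Phi' p vee ->
  (forall x', X' x' -> hom_on X (p^~ x')) /\ (forall x, X x -> hom_on X' (p x)).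
Proof.
move=> h; split=> [x' Xx' x y Xx Xy | x Xx x' y' Xx' Xy'].
  exact: (rd_pairDl h).
exact: (rd_pairDr h).
Qed.

(** * The lattice Lambda *)

Lemma dvdz_mul_divgcd (n : nat) (a b : int) : (0 < n)%N ->
  (n%:Z %| a * b)%Z = ((n %/ gcdn n `|b|)%N%:Z %| a)%Z.
Proof.
move=> n0; rewrite !dvdzE abszM /=.
set g := gcdn n `|b|; have g0 : (0 < g)%N by rewrite gcdn_gt0 n0.
rewrite -[X in (X %| _)%N](divnK (dvdn_gcdl n `|b|)) -/g.
rewrite -[X in (_ %| _ * X)%N](divnK (dvdn_gcdr n `|b|)) -/g.
rewrite mulnA dvdn_pmul2r // Gauss_dvdl // /coprime.
by rewrite -(eqn_pmul2r g0) mul1n muln_gcdl !divnK ?dvdn_gcdl ?dvdn_gcdr.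
Qed.

Lemma dvdz_mulmx (m r s : nat) (d : int) (z : 'M[int]_(m, r))
    (R : 'M[int]_(r, s)) :
  (forall i j, (d %| z i j)%Z) -> forall i j, (d %| (z *m R) i j)%Z.
Proof.
by move=> dz i j; rewrite mxE; apply: rpred_sum => k _; apply: dvdz_mulr.
Qed.

(** With [G = L D R] the Smith form of the Gram matrix, a row vector [u] of
coordinates lies in [Lambda] exactly when [n] divides [u L D], that is, when the
i-th entry of [u L] is divisible by [n / gcd(n, d_i)]; so the rows of the diagonal
matrix of these numbers times [L^-1] are the coordinates of a basis. *)
Lemma Lambda_lattice (Y : zmodType) (B : Y -> Y -> int) (n : nat) :
  lattice [set: Y] -> (forall y, hom_on [set: Y] (B^~ y)) ->
  (forall x, hom_on [set: Y] (B x)) -> (0 < n)%N -> lattice (Lambda B n).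
Proof.
move=> lY Bl Br n0; have sY := @subgroupT Y; case: lY => r [e [eY efree]].
pose G : 'M[int]_r := \matrix_(i, j) B (e i) (e j).
have [L uL [R uR [d _ GE]]] := int_Smith_normal_form G.
pose D : 'M[int]_r := \matrix_(i, j) (d`_i *+ (i == j :> nat)).
pose q (i : 'I_r) : int := d`_i.
pose m i : int := (n %/ gcdn n `|q i|)%N%:Z.
have m0 i : m i != 0.
  by rewrite -lt0n divn_gt0 ?gcdn_gt0 ?n0 // dvdn_leq // dvdn_gcdl.
pose E : 'M[int]_r := diag_mx (\row_i m i).
pose ev (u : 'rV[int]_r) := \sum_i e i *~ u 0 i.
pose b i := ev (row i (E *m invmx L)).
have evM (w : 'rV_r) : ev (w *m (E *m invmx L)) = \sum_i b i *~ w 0 i.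
  rewrite /ev /b /ev; under [RHS]eq_bigr do rewrite mulrz_suml.
  rewrite exchange_big; apply: eq_bigr => j _ /=.
  rewrite mxE mulrz_sumr; apply: eq_bigr => i _.
  by rewrite [in RHS]mxE mulrC mulrzA.
have LambdaE u : Lambda B n (ev u) <-> forall i, (m i %| (u *m L) 0%R i)%Z.
  have BE j : B (ev u) (e j) = (u *m G) 0 j.
    rewrite (hom_on_comb sY _ (Bl _)) // mxE; apply: eq_bigr => i _.
    by rewrite mulrzz mxE mulrC.
  have uLDE i : (u *m L *m D) 0 i = (u *m L) 0 i * q i.
    rewrite mxE (bigD1 i) //= [D i i]mxE eqxx mulr1n big1 ?addr0 // => k.
    by rewrite [D k i]mxE -val_eqE /= => /negPf->; rewrite mulr0n mulr0.
  split=> [Lu i|Lu y].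
    rewrite -dvdz_mul_divgcd // -uLDE.
    have -> : u *m L *m D = (u *m G) *m invmx R.
      by rewrite GE -/D -!mulmxA mulmxV // mulmx1.
    by apply: dvdz_mulmx => k j; rewrite ord1 -BE; apply: Lu.
  have [c ->] := (eY y).1 I.
  rewrite (hom_on_comb sY _ (Br _)) //.
  apply: rpred_sum => j _; rewrite mulrzz; apply: dvdz_mulr.
  rewrite BE GE -/D !mulmxA; apply: dvdz_mulmx => k i.
  by rewrite ord1 uLDE dvdz_mul_divgcd.
exists r, b; split=> [x|c]; last first.
  move=> c0 i; pose w : 'rV[int]_r := \row_i c i.
  have : ev (w *m (E *m invmx L)) = 0.
    by rewrite evM -[RHS]c0; apply: eq_bigr => j _; rewrite mxE.
  move/efree => wT0.
  have {}wT0 : w *m (E *m invmx L) = 0.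
    by apply/rowP => j; rewrite wT0 mxE.
  have : w *m E = 0 by rewrite -(mulmxKV uL (w *m E)) -(mulmxA w) wT0 mul0mx.
  move/rowP/(_ i)/eqP; rewrite mul_mx_diag !mxE mulf_eq0 (negPf (m0 i)) orbF.
  by move/eqP.
split.
  have [c ->] := (eY x).1 I.
  pose u : 'rV[int]_r := \row_i c i.
  have -> : \sum_i e i *~ c i = ev u by apply: eq_bigr => i _; rewrite mxE.
  move/LambdaE => mu.
  pose w : 'rV[int]_r := \row_i ((u *m L) 0%R i %/ m i)%Z.
  have -> : u = w *m (E *m invmx L).
    rewrite mulmxA -[LHS](mulmxK uL); congr (_ *m _); apply/rowP => i.
    by rewrite mul_mx_diag !mxE divzK //; have := mu i; rewrite !mxE.
  by rewrite evM; exists (fun i => w 0 i).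
case=> c ->; pose w : 'rV[int]_r := \row_i c i.
have -> : \sum_i b i *~ c i = ev (w *m (E *m invmx L)).
  by rewrite evM; apply: eq_bigr => i _; rewrite mxE.
apply/LambdaE => i; rewrite mulmxA mulmxKV // mul_mx_diag !mxE.
exact: dvdz_mull.
Qed.

(** * Reflections that preserve a finite set *)

Lemma finite_progression (V : zmodType) (R : set V) (b d : V) :
  torsion_free V -> finite_set R -> (forall k : nat, R (b + d *+ k)) -> d = 0.
Proof.
move=> tf finR Rbd; apply: contrapT => d0.
have := infinite_nat; apply; rewrite -[setT](_ : (fun k => b + d *+ k) @^-1` R = _).
  apply: finite_preimage => // i j _ _ /addrI.
  wlog: i j / (i <= j)%N => [H|ij dij].
    by case/orP: (leq_total i j) => [/H//|/H{}H /esym/H].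
  apply/eqP; rewrite eqn_leq ij /= -subn_eq0; apply/eqP.
  have [//|k0] := posnP (j - i); case: d0; apply: (tf _ _ k0).
  by rewrite mulrnBr // dij subrr.
by apply/seteqP; split=> k //= _; apply: Rbd.
Qed.

(** Put [t = f b] and [d = t a - 2 b].  Proportionality of [f] and [g] makes both
of them vanish at [d], and [s_a s_b] sends [b] to [b + d] and fixes [d]: it maps
[b + k d] to [b + (k + 1) d].  All these lie in the finite set [R], so [d = 0];
and [t m = 2 n] turns [t a = 2 b] into the conclusion. *)
Lemma proportional_reflections (V : zmodType) (R : set V) (f g : V -> int)
    (a b : V) (m n : nat) :
  torsion_free V -> finite_set R ->
  hom_on [set: V] f -> hom_on [set: V] g -> f a = 2 -> g b = 2 ->
  (0 < m)%N -> (0 < n)%N -> (forall x, f x *+ m = g x *+ n) ->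
  R b -> (forall x, R x -> R (x - a *~ f x)) ->
  (forall x, R x -> R (x - b *~ g x)) -> a *+ n = b *+ m.
Proof.
move=> tf finR fD gD fa gb m0 n0 fg Rb sa sb; have sV := @subgroupT V.
have addf x y : f (x + y) = f x + f y by apply: fD.
have addg x y : g (x + y) = g x + g y by apply: gD.
have fZ x z : f (x *~ z) = f x *~ z by apply: (hom_onMz sV z fD).
have gZ x z : g (x *~ z) = g x *~ z by apply: (hom_onMz sV z gD).
pose t := f b; pose d := a *~ t - b *~ 2.
have tm : t *+ m = 2 *+ n by rewrite fg gb.
have fd : f d = 0.
  by rewrite addf -mulrNz !fZ fa -/t mulrNz !mulrzz mulrC subrr.
have gd : g d = 0.
  have /eqP := fg d; rewrite fd mul0rn eq_sym mulrn_eq0.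
  by rewrite -leqn0 leqNgt n0 => /eqP.
have Rbd (k : nat) : R (b + d *+ k).
  elim: k => [|k IHk]; first by rewrite mulr0n addr0.
  have := sa _ (sb _ IHk).
  have -> : g (b + d *+ k) = 2 by rewrite addg pmulrn gZ gd gb mul0rz addr0.
  set x := (x in R (x - a *~ f x)).
  have -> : f x = - t.
    by rewrite /x -mulrNz !addf !fZ pmulrn fZ fd mul0rz addr0 -/t mulrzz mulrN
      mulr_natr mulr2n opprD addrA subrr add0r.
  congr R; rewrite /x mulrNz opprK [d *+ k.+1]mulrSr -!addrA; congr (_ + (_ + _)).
  exact: addrC.
have d0 := finite_progression tf finR Rbd.
have at2 : a *~ t = b *~ 2 by apply/eqP; rewrite -subr_eq0 -/d d0.
apply/eqP; rewrite -subr_eq0; apply/eqP; apply: (tf _ 2) => //.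
have tm2 : t * m%:Z = (n * 2)%N%:Z.
  by rewrite -mulrzz -pmulrn tm pmulrn mulrzz PoszM mulrC.
have e : a *+ n *+ 2 = a *~ t *+ m.
  by rewrite -mulrnA [LHS]pmulrn -tm2 mulrzA -pmulrn.
by rewrite mulrnBl e at2 -pmulrn mulrnAC subrr.
Qed.

(** Let [c'] be the reflection of [b] in [a].  The conjugate of [s_b] by [s_a] is
the reflection with vector [c'] and covector [s_a (vee b) = vee c], and the
reflection in [c] has the same covector; so [c = c']. *)
Lemma root_datum_reflection_vee (Y M : zmodType) (p : Y -> M -> int)
    (Delta : set Y) (vee : Y -> M) (a b c : Y) :
  root_datum [set: Y] Delta [set: M] (vee @` Delta) p vee ->
  Delta a -> Delta b -> Delta c ->
  vee c = reflection (fun x' x => p x x') (vee a) a (vee b) ->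
  c = reflection p a (vee a) b.
Proof.
move=> hG Da Db Dc cE; have [sY sM] := (@subgroupT Y, @subgroupT M).
have [pl pr] := pairing_additive hG.
have pDl m : hom_on [set: Y] (p^~ m) by apply: pl.
have pDr y : hom_on [set: M] (p y) by apply: pr.
have addl x y m : p (x + y) m = p x m + p y m by apply: pDl.
have Nl x m : p (- x) m = - p x m by apply: (hom_onN sY (pDl m)).
have Ml x z m : p (x *~ z) m = p x m * z.
  by rewrite (hom_onMz sY _ (pDl m)) ?mulrzz.
have pc x : p x (vee c) = p x (vee b) - p x (vee a) * p a (vee b).
  rewrite cE /reflection pDr // (hom_onN sM (pDr x)) //.
  by rewrite (hom_onMz sM _ (pDr x)) // mulrzz.
have stable e : Delta e -> forall x, Delta x -> Delta (x - e *~ p x (vee e)).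
  by move=> De x Dx; rewrite -(rd_refl hG De); exists x.
set c' := reflection p a (vee a) b.
have c'E : c' = b - a *~ p b (vee a) by [].
have [paa pbb] := (rd_pair2 hG Da, rd_pair2 hG Db).
rewrite -[c]mulr1n -[c']mulr1n.
apply: (proportional_reflections (lattice_torsion_free (rd_lattice hG))
  (rd_finite hG) (pDl (vee c)) (pDl (vee c))) => //.
- exact: (rd_pair2 hG).
- rewrite pc c'E !addl !Nl !Ml paa pbb; ring.
- by rewrite c'E; apply: stable.
- exact: stable.
- move=> x Dx.
  have := stable _ Da _ (stable _ Db _ (stable _ Da _ Dx)).
  have -> : p (x - a *~ p x (vee a)) (vee b) = p x (vee c).
    by rewrite pc addl Nl Ml mulrC.
  set k := p x (vee c).
  have -> : p (x - a *~ p x (vee a) - b *~ k) (vee a) =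
      - (p x (vee a) + p b (vee a) * k).
    by rewrite !addl !Nl !Ml paa; ring.
  rewrite mulrNz opprK mulrzDr c'E mulrzBl opprB -mulrzA addrA.
  by rewrite [_ - b *~ k + _]addrAC subrK -addrA [- _ + _]addrC.
Qed.

(** * The invariant form on coroots *)

(** Apply invariance under the reflection in [a] to [B y a]: it sends [a] to [- a]
and [y] to [y - p y (vee a) a], whence [2 B y a = p y (vee a) B a a]. *)
Lemma invariant_form_coroot (Y M : zmodType) (Delta : set Y)
    (p : Y -> M -> int) (vee : Y -> M) (B : Y -> Y -> int) (a y : Y) :
  invariant_form Delta p vee B -> Delta a -> p a (vee a) = 2 ->
  B y a = p y (vee a) * Qform B a.
Proof.
move=> hB Da paa; have sY := @subgroupT Y.
have Bl z : hom_on [set: Y] (B^~ z) by move=> x t _ _; apply: (form_addl hB).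
have Nl x z : B (- x) z = - B x z by apply: (hom_onN sY (Bl z)).
have sa : reflection p a (vee a) a = - a.
  by rewrite /reflection paa -[2]/(1 + 1) mulrzDr mulr1z opprD addrA subrr sub0r.
have := form_weyl hB (weyl_refl Da (weyl_id _ _ _)) y a.
rewrite /= sa (form_sym hB) Nl (form_sym hB) /reflection (form_addl hB) Nl.
rewrite (hom_onMz sY _ (Bl a)) // mulrzz.
rewrite -[B a a](divzK (form_even hB Da)) -/(Qform B a) => e.
apply: (mulIf (_ : 2 != 0 :> int)) => //.
lia.
Qed.

Lemma n_coroot_gt0 (Y : zmodType) (B : Y -> Y -> int) (n : nat) (a : Y) :
  (0 < n)%N -> (0 < n_coroot B n a)%N.
Proof.
by move=> n0; rewrite divn_gt0 ?gcdn_gt0 ?n0 // dvdn_leq // dvdn_gcdl.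
Qed.

(** * Rational characters *)

(** Take a basis [e] of [Y] and the dual basis [mu] of [M].  The right-hand side is
a linear endomorphism of [MQ] that agrees with the identity on the image of
[iota], so the two are equal by the uniqueness in the universal property. *)
Lemma tensorQ_coord (Y M : zmodType) (p : Y -> M -> int) (Phi : set Y)
    (Phi' : set M) (vee : Y -> M) (MQ : lmodType rat)
    (iota : {additive M -> MQ}) (pQ : Y -> {scalar MQ}) :
  root_datum [set: Y] Phi [set: M] Phi' p vee -> is_tensorQ iota ->
  (forall y m, pQ y (iota m) = (p y m)%:~R) ->
  exists r (e : 'I_r -> Y) (mu : 'I_r -> M),
    forall chi, chi = \sum_i pQ (e i) chi *: iota (mu i).
Proof.
move=> hG hMQ hpQ; have [sY sM] := (@subgroupT Y, @subgroupT M).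
have [pl pr] := pairing_additive hG.
have pDl m : hom_on [set: Y] (p^~ m) by apply: pl.
have pDr y : hom_on [set: M] (p y) by apply: pr.
have [r [e [c [_ chom _ cE]]]] := lattice_coord (rd_lattice hG).
have /choice[mu muP] : forall i, exists m, forall y, p y m = c i y.
  move=> i; have [m [[_ mP] _]] := rd_perfect hG (chom i).
  by exists m => y; apply: mP.
exists r, e, mu.
pose h (chi : MQ) : MQ := \sum_i pQ (e i) chi *: iota (mu i).
have hlin : linear h.
  move=> t x y; rewrite /h scaler_sumr -big_split; apply: eq_bigr => i _ /=.
  by rewrite linearD linearZ_LR /= scalerDl scalerA.
pose hL : {linear MQ -> MQ} := HB.pack h (GRing.isLinear.Build _ _ _ _ h hlin).
have hiota m : h (iota m) = iota m.
  rewrite /h; under eq_bigr do rewrite hpQ scaler_int -raddfMz.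
  rewrite -raddf_sum; congr (iota _).
  have [m' [_ m'U]] := rd_perfect hG (pDl m).
  transitivity m'; last by apply: m'U.
  apply/esym/m'U; split=> // y _.
  rewrite (hom_on_comb sM _ (pDr y)) // [in RHS](cE y) //.
  rewrite (hom_on_comb sY _ (pDl m)) //=.
  by apply: eq_bigr => i _; rewrite muP !mulrzz mulrC.
have [g [_ gU]] := hMQ MQ iota.
by move=> chi; rewrite -[RHS]/(hL chi) (gU hL hiota) -(gU idfun).
Qed.

(** The family [pQ] is only assumed to be linear in the character; its additivity
in [Y] is inherited from [p], through the coordinates of a character. *)
Lemma scalar_additive (Y M : zmodType) (p : Y -> M -> int) (Phi : set Y)
    (Phi' : set M) (vee : Y -> M) (MQ : lmodType rat)
    (iota : {additive M -> MQ}) (pQ : Y -> {scalar MQ}) x y chi :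
  root_datum [set: Y] Phi [set: M] Phi' p vee -> is_tensorQ iota ->
  (forall y m, pQ y (iota m) = (p y m)%:~R) ->
  pQ (x + y) chi = pQ x chi + pQ y chi.
Proof.
move=> hG hMQ hpQ; have [r [e [mu E]]] := tensorQ_coord hG hMQ hpQ.
rewrite (E chi) !linear_sum -big_split; apply: eq_bigr => i _ /=.
by rewrite !linearZ_LR /= !hpQ (rd_pairDl hG) // rmorphD mulrDr.
Qed.

Lemma int_pairingE (Y : zmodType) (MQ : lmodType rat) (pQ : Y -> {scalar MQ})
    (L : set Y) x chi :
  L x -> hom_lattice pQ L chi -> (int_pairing pQ x chi)%:~R = pQ x chi.
Proof. by move=> Lx [f _ fE]; rewrite /int_pairing fE // intrKfloor. Qed.

Lemma hom_latticeP (Y : zmodType) (MQ : lmodType rat) (pQ : Y -> {scalar MQ})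
    (L : set Y) chi :
  (forall x y, pQ (x + y) chi = pQ x chi + pQ y chi) ->
  (forall x, L x -> pQ x chi \is a Num.int) -> hom_lattice pQ L chi.
Proof.
move=> pD pint; exists (fun x => int_pairing pQ x chi).
  by move=> x y Lx Ly; rewrite /int_pairing pD floorDzr // pint.
by move=> x Lx; rewrite /int_pairing floorK // pint.
Qed.

Lemma hom_lattice_subgroup (Y : zmodType) (MQ : lmodType rat)
    (pQ : Y -> {scalar MQ}) (L : set Y) : subgroup (hom_lattice pQ L).
Proof.
split.
- by exists (fun=> 0) => [x y _ _ | x _]; rewrite ?addr0 // linear0.
- move=> x y [f fD fE] [g gD gE]; exists (fun z => f z + g z).
    by move=> z t Lz Lt; rewrite fD // gD // addrACA.
  by move=> z Lz; rewrite linearD fE // gE // rmorphD.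
- move=> x [f fD fE]; exists (fun z => - f z).
    by move=> z t Lz Lt; rewrite fD // opprD.
  by move=> z Lz; rewrite linearN fE // rmorphN.
Qed.

(** Since [y *+ n] lies in [L], the function [y |-> f (y *+ n)] is a homomorphism
on the whole of [Y], hence the pairing with some [m] in [M]; the character is
[m / n].  It is unique because its values on [L] determine those on [Y]. *)
Lemma hom_lattice_perfect (Y M : zmodType) (p : Y -> M -> int) (Phi : set Y)
    (Phi' : set M) (vee : Y -> M) (MQ : lmodType rat)
    (iota : {additive M -> MQ}) (pQ : Y -> {scalar MQ}) (L : set Y) (n : nat) :
  root_datum [set: Y] Phi [set: M] Phi' p vee -> is_tensorQ iota ->
  (forall y m, pQ y (iota m) = (p y m)%:~R) ->
  subgroup L -> (0 < n)%N -> (forall y, L (y *+ n)) ->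
  forall f, hom_on L f -> exists! chi, hom_lattice pQ L chi /\
    forall x, L x -> int_pairing pQ x chi = f x.
Proof.
move=> hG hMQ hpQ sL n0 nL f fD; have sY := @subgroupT Y.
have n0Q : n%:R != 0 :> rat by rewrite pnatr_eq0 -lt0n.
have fnD : hom_on [set: Y] (fun y => f (y *+ n)).
  by move=> x y _ _; rewrite mulrnDl fD.
have [m [[_ mE] _]] := rd_perfect hG fnD.
pose chi := n%:R^-1 *: iota m.
have chiE x : L x -> pQ x chi = (f x)%:~R.
  move=> Lx; rewrite /chi linearZ_LR /= hpQ mE // (hom_onMn sL) //.
  by rewrite rmorphMn /= -[_%:~R *+ n]mulr_natr mulrC mulfK.
have Lchi : hom_lattice pQ L chi by exists f.
exists chi; split.
  by split=> // x Lx; apply: (@intr_inj rat); rewrite (int_pairingE Lx) // chiE.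
move=> chi' [Lchi' chi'E].
have pQMn y (psi : MQ) : pQ (y *+ n) psi = pQ y psi * n%:R.
  rewrite mulr_natr -(prednK n0); elim: n.-1 => [|k IHk]; first by rewrite !mulr1n.
  by rewrite mulrS (scalar_additive _ _ _ hG hMQ hpQ) IHk -mulrS.
have same y : pQ y chi = pQ y chi'.
  apply: (mulIf n0Q); rewrite -!pQMn chiE // -chi'E //.
  exact: int_pairingE (nL y) Lchi'.
have [r [e [mu E]]] := tensorQ_coord hG hMQ hpQ.
by rewrite (E chi) (E chi'); apply: eq_bigr => i _; rewrite same.
Qed.

(** * The root datum *)

Theorem theorem11p1
  (* the local field F, its residue field k (q = #|k|), and n *)
  (F : fieldType) (v : F -> int) (k : finFieldType) (res : F -> k)
  (hF : local_field v res)
  (n : nat) (hn : (0 < n)%N) (hq : (2 * n %| #|k| - 1)%N)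
  (* Y = Hom(G_m, T), M = Hom(T, G_m), the coroots Delta, coroot |-> root *)
  (Y M : zmodType) (p : Y -> M -> int)
  (Delta : set Y) (vee : Y -> M)
  (hG : root_datum [set: Y] Delta [set: M] (vee @` Delta) p vee)
  (hred : reduced Delta)
  (B : Y -> Y -> int) (hB : invariant_form Delta p vee B)
  (* MQ = Hom(T, G_m) (x) Q with the Q-linear extension of the pairing *)
  (MQ : lmodType rat) (iota : {additive M -> MQ}) (hMQ : is_tensorQ iota)
  (pQ : Y -> {scalar MQ})
  (hpQ : forall y m, pQ y (iota m) = (p y m)%:~R) :
  let X := Lambda B n in
  let Phi := [set a *+ n_coroot B n a | a in Delta] in
  let X' := hom_lattice pQ X in
  let Phi' := [set (n_coroot B n a)%:R^-1 *: iota (vee a) | a in Delta] in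
  exists vee' : Y -> MQ,
    (forall a, Delta a ->
      vee' (a *+ n_coroot B n a) = (n_coroot B n a)%:R^-1 *: iota (vee a)) /\
    root_datum X Phi X' Phi' (int_pairing pQ) vee'.
Proof.
move=> X Phi X' Phi'.
have [sY sM] := (@subgroupT Y, @subgroupT M).
have [pl pr] := pairing_additive hG.
have tfY := lattice_torsion_free (rd_lattice hG).
pose N a := n_coroot B n a.
have N0 a : (0 < N a)%N by apply: n_coroot_gt0.
have NQ0 a : (N a)%:R != 0 :> rat by rewrite pnatr_eq0 -lt0n.
have Bl z : hom_on [set: Y] (B^~ z) by move=> x t _ _; apply: (form_addl hB).
have Br z : hom_on [set: Y] (B z).
  by move=> x t _ _; rewrite !(form_sym hB z); apply: Bl.
have Bcoroot y a : Delta a -> B y a = p y (vee a) * Qform B a.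
  by move=> Da; apply: invariant_form_coroot hB Da (rd_pair2 hG Da).
have lX : lattice X by apply: Lambda_lattice (rd_lattice hG) Bl Br hn.
have sX := lattice_subgroup lX.
have Xcoroot a : Delta a -> X (a *+ N a).
  move=> Da y; rewrite (form_sym hB) (hom_onMn sY _ (Br y)) // Bcoroot //.
  rewrite -mulrnAl dvdz_mul_divgcd // -[_ *+ N a]mulr_natr natz.
  exact: dvdz_mull (dvdzz _).
have Xdvd x a : Delta a -> X x -> (N a %| p x (vee a))%Z.
  by move=> Da Xx; rewrite -dvdz_mul_divgcd // -Bcoroot //; apply: Xx.
have XMn y : X (y *+ n).
  move=> z; rewrite (hom_onMn sY _ (Bl z)) // -[_ *+ n]mulr_natr natz.
  exact: dvdz_mull (dvdzz _).
have perfX := hom_lattice_perfect hG hMQ hpQ sX hn XMn.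
have pQD chi x y : pQ (x + y) chi = pQ x chi + pQ y chi.
  exact: (scalar_additive _ _ _ hG hMQ hpQ).
have pQroot x b : pQ x ((N b)%:R^-1 *: iota (vee b)) = (p x (vee b))%:~R / (N b)%:R.
  by rewrite linearZ_LR /= hpQ mulrC.
have X'root b : Delta b -> X' ((N b)%:R^-1 *: iota (vee b)).
  move=> Db; apply: hom_latticeP => // x Xx; rewrite pQroot.
  by have /dvdzP[z ->] := Xdvd _ _ Db Xx; rewrite rmorphM /= -pmulrn mulfK // intr_int.
have ipE x chi : X x -> X' chi -> (int_pairing pQ x chi)%:~R = pQ x chi.
  by move=> Xx Xchi; apply: int_pairingE Xx Xchi.
have sX' : subgroup X' by apply: hom_lattice_subgroup.
have ipl chi : X' chi -> hom_on X ((int_pairing pQ)^~ chi).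
  move=> Xchi x y Xx Xy; apply: (@intr_inj rat); rewrite rmorphD /= !ipE //.
  by case: sX => _ XD _; apply: XD.
have ipr x : X x -> hom_on X' (int_pairing pQ x).
  move=> Xx chi psi Xchi Xpsi; apply: (@intr_inj rat).
  rewrite rmorphD /= !ipE ?linearD //.
  by case: sX' => _ XD _; apply: XD.
have [lX' perfX'] := perfect_dual lX sX' ipl ipr perfX.
(* b = - a is excluded because a and b have a common positive multiple *)
have scaled_inj a b : Delta a -> Delta b -> a *+ N a = b *+ N b -> b = a.
  move=> Da Db ab; case: (hred a b (N a)%:Z (N b)%:Z) => //; rewrite -?lt0n //.
  move=> ba; have a0 : a = 0.
    apply: (tfY _ (N a + N b)%N); first by rewrite addn_gt0 N0.
    by rewrite mulrnDr ab ba mulNrn addNr.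
  have := rd_pair2 hG Da; rewrite {1}a0 (hom_on0 sY (pl _ _)) //.
(* scaled_inj makes the value at x independent of the coroot chosen *)
have /choice[vee' vee'P] : forall x, exists chi, forall a, Delta a ->
    a *+ N a = x -> chi = (N a)%:R^-1 *: iota (vee a).
  move=> x; have [[a Da ax]|no] := pselect (Phi x).
    exists ((N a)%:R^-1 *: iota (vee a)) => b Db bx.
    by rewrite (scaled_inj a b) // ax bx.
  by exists 0 => a Da ax; case: no; exists a.
have vee'E a : Delta a -> vee' (a *+ N a) = (N a)%:R^-1 *: iota (vee a).
  by move=> Da; apply: vee'P.
have Nrefl a b : Delta a -> N (reflection p a (vee a) b) = N b.
  move=> Da; rewrite /N /n_coroot /Qform.
  by have /= -> := form_weyl hB (weyl_refl Da (weyl_id _ _ _)) b b.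
have stable a b : Delta a -> Delta b -> Delta (reflection p a (vee a) b).
  by move=> Da Db; rewrite -(rd_refl hG Da); exists b.
(* the factor N a of the vector cancels the factor (N a)^-1 of the covector *)
have reflE a b : Delta a -> Delta b ->
    reflection (int_pairing pQ) (a *+ N a) (vee' (a *+ N a)) (b *+ N b) =
    reflection p a (vee a) b *+ N (reflection p a (vee a) b).
  move=> Da Db; rewrite Nrefl // /reflection vee'E //.
  have ip : (N a)%:Z * int_pairing pQ (b *+ N b) ((N a)%:R^-1 *: iota (vee a))
      = p b (vee a) *+ N b.
    apply: (@intr_inj rat); rewrite rmorphM /= ipE //; try exact: Xcoroot.
      by rewrite pQroot mulrC divfK // (hom_onMn sY _ (pl _ _)).
    exact: X'root.
  rewrite mulrnBl; congr (_ - _).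
  by rewrite [a *+ _]pmulrn -mulrzA ip [RHS]pmulrn -mulrzA -mulrzz -pmulrn.
have reflE' a b : Delta a -> Delta b ->
    reflection (fun x' x => int_pairing pQ x x') (vee' (a *+ N a)) (a *+ N a)
      ((N b)%:R^-1 *: iota (vee b)) =
    (N b)%:R^-1 *: iota (reflection (fun x' x => p x x') (vee a) a (vee b)).
  move=> Da Db; rewrite /reflection vee'E // raddfB raddfMz scalerBr.
  congr (_ - _); rewrite -!scaler_int ipE; try exact: Xcoroot; last exact: X'root.
  rewrite pQroot (hom_onMn sY _ (pl _ _)) // !scalerA; congr (_ *: _).
  by rewrite rmorphMn /= -mulr_natr mulrAC mulfK // mulrC.
have Nvee a b c : Delta a -> Delta b -> Delta c ->
    reflection (fun x' x => p x x') (vee a) a (vee b) = vee c -> N c = N b.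
  move=> Da Db Dc bc.
  by rewrite (root_datum_reflection_vee hG Da Db Dc (esym bc)) Nrefl.
exists vee'; split; first exact: vee'E.
split; first exact: lX.
- exact: lX'.
- by move=> x y x' Xx Xy Xx'; apply: ipl.
- by move=> x x' y' Xx Xx' Xy'; apply: ipr.
- exact: perfX.
- exact: perfX'.
- by move=> _ [a Da <-]; apply: Xcoroot.
- by move=> _ [a Da <-]; apply: X'root.
- exact: finite_image (rd_finite hG).
- split.
  + by move=> _ [a Da <-]; exists a => //; rewrite vee'E.
  + move=> _ _ /set_mem[a Da <-] /set_mem[b Db <-]; rewrite !vee'E // => ab.
    apply: (proportional_reflections tfY (rd_finite hG) (pl (vee a) I)
      (pl (vee b) I) (rd_pair2 hG Da) (rd_pair2 hG Db) (N0 b) (N0 a)) => //.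
    * move=> x; apply: (@intr_inj rat).
      rewrite -[p x (vee a) *+ _]mulr_natr -[p x (vee b) *+ _]mulr_natr !intrM !rmorph_nat.
      have := congr1 (pQ x) ab; rewrite !pQroot => /eqP.
      by rewrite eqr_div // => /eqP.
    * by move=> x; apply: stable.
    * by move=> x; apply: stable.
  + by move=> _ [a Da <-]; exists (a *+ N a); [exists a | rewrite vee'E].
- move=> _ [a Da <-]; apply: (@intr_inj rat).
  rewrite vee'E // ipE; [|exact: Xcoroot|exact: X'root].
  by rewrite pQroot (hom_onMn sY _ (pl _ _)) // (rd_pair2 hG) // rmorphMn /=
    -mulr_natr mulfK.
- move=> _ [a Da <-]; apply/seteqP; split=> [_ [_ [b Db <-] <-] | _ [c Dc <-]].
    by rewrite reflE //; exists (reflection p a (vee a) b) => //; apply: stable.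
  have [b Db bc] : (reflection p a (vee a) @` Delta) c by rewrite (rd_refl hG).
  by exists (b *+ N b); [exists b | rewrite reflE // bc].
- move=> _ [a Da <-]; apply/seteqP; split=> [_ [_ [b Db <-] <-] | _ [c Dc <-]].
    have [c Dc cE] : (vee @` Delta)
        (reflection (fun x' x => p x x') (vee a) a (vee b)).
      by rewrite -(rd_refl' hG Da); exists (vee b) => //; exists b.
    by exists c => //; rewrite reflE' // -/(N _) (Nvee a b c) // cE.
  have : (vee @` Delta) (vee c) by exists c.
  rewrite -{1}(rd_refl' hG Da) => -[_ [b Db <-] bc].
  exists ((N b)%:R^-1 *: iota (vee b)); first by exists b.
  by rewrite reflE' // bc -/(N c) (Nvee a b c).
Qed.
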